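(* Let a quantum graph have transfer matrices $\Phi_{\bf e}=\Phi_{\bf e}(k)$ as in the context, and let $k$ be such that $\mathbb 1-\Phi_{\bf e}\Phi_{-{\bf e}}$ is invertible for every oriented edge ${\bf e}$ (so that $\mathbb 1+\Phi\hat\tau$ is invertible). Then the matrix $$\mathfrak{A} :=\widehat{\delta_t^*} \left( 2\,(\mathbb{1} + \Phi \hat{\tau})^{-1}- \mathbb{1} \right)\widehat{\delta_t}$$ has, as an $n\times n$ matrix of $2\times 2$ blocks indexed by vertices $v,w$, the form $$\mathfrak{A}_{vw} = \begin{cases} 2 \displaystyle\sum_{\{{\bf e}:\, v\rightarrow w\}} (\Phi_{-{\bf e}}^{-1}- \Phi_{\bf e})^{-1}, & \text{if } v \neq w, \\[2ex] \displaystyle\sum_{\{{\bf e}:\, {\bf e}\rightarrow v\}}(\Phi_{-{\bf e}}^{-1}+ \Phi_{\bf e})(\Phi_{-{\bf e}}^{-1}- \Phi_{\bf e}), & \text{if } v= w. \end{cases}$$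
   Context: The graph has $n$ vertices and $m$ edges; each edge gives two oriented edges, ${\bf e}$ and its reversal $-{\bf e}$, with source $s({\bf e})$ and terminal vertex $t({\bf e})$. The notation $\{{\bf e}: v\rightarrow w\}$ means the oriented edges with source $v$ and terminal vertex $w$, and $\{{\bf e}:{\bf e}\rightarrow v\}$ means the oriented edges with terminal vertex $v$. $\delta_t^*$ is the $n\times 2m$ matrix with $(\delta_t^* )_{t({\bf e}),{\bf e}}=1$ and all other entries $0$; $\delta_t$ is its adjoint. $\tau$ is the $2m\times 2m$ permutation matrix of ${\bf e}\mapsto-{\bf e}$. For a matrix $M$, $\hat M:=M\otimes\mathbb 1_2$. To each oriented edge is attached an invertible $2\times2$ transfer matrix $\Phi_{\bf e}(k)$, entire in $k$, with $\Phi_{-{\bf e}}=\sigma\Phi_{\bf e}^{-1}\sigma$, $\sigma=\operatorname{diag}(1,-1)$ (it maps the pair (value, derivative) of solutions of $-\psi''+V\psi=k^2\psi$ on the edge from $s({\bf e})$ to $t({\bf e})$). $\Phi$ is the $4m\times4m$ block-diagonal matrix with blocks $\Phi_{\bf e}(k)$ indexed by oriented edges.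
   Formalization: The printed formula is false; proved instead: the off-diagonal blocks carry −2 in place of 2, the second diagonal factor is inverted, (Φ_{-e}^{-1}−Φ_e)^{-1}, and the diagonal block at v gains the loop term −2 Σ_{e: v→v}(Φ_{-e}^{-1}−Φ_e)^{-1}. *)

(* Defs.v *)
From HB Require Import structures.
From mathcomp Require Import all_boot all_order all_algebra all_fingroup.
From mathcomp Require Import spectral.
From mathcomp Require Import all_classical all_reals all_analysis.
From mathcomp Require Import complex mxtens.

Set Implicit Arguments.
Unset Strict Implicit.
Unset Printing Implicit Defensive.

Import Order.TTheory GRing.Theory Num.Theory.
Import numFieldNormedType.Exports.
Local Open Scope ring_scope.
Local Open Scope sesquilinear_scope.
Local Open Scope classical_set_scope.

(* A finite multigraph (loops and multiple edges allowed) presented by its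
   2m oriented edges; [orev e] is the reversal -e, so that the m unoriented
   edges are the orbits of [orev]. *)
Record graph (n m : nat) := Graph {
  src : 'I_(2 * m) -> 'I_n;
  tgt : 'I_(2 * m) -> 'I_n;
  orev : 'I_(2 * m) -> 'I_(2 * m);
  orev_involutive : involutive orev;
  orev_neq : forall e, orev e != e;
  src_orev : forall e, src (orev e) = tgt e }.

(* [complex R] carries no canonical topology in MathComp-Analysis; going
   through a numFieldType gives it the one of its norm. *)
Definition cplxField (R : realType) : numFieldType := R[i].

Definition entire (R : realType) (f : R[i] -> R[i]) : Prop :=
  forall z : cplxField R,
    derivable (f : cplxField R -> (cplxField R)^o) z 1.

Definition cderiv (R : realType) (f : R -> R[i]) (x : R) (d : R[i]) : Prop :=
  is_derive x 1 (fun y => complex.Re (f y)) (complex.Re d) /\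
  is_derive x 1 (fun y => complex.Im (f y)) (complex.Im d).

Definition ccontinuous_on (R : realType) (A : set R) (f : R -> R[i]) : Prop :=
  {within A, continuous (fun y => complex.Re (f y))} /\
  {within A, continuous (fun y => complex.Im (f y))}.

(* Classical solutions only: for merely integrable V this asks less of the
   transfer matrices, hence is a weaker hypothesis on them.
   - psi'' + V psi = k^2 psi on [0, l], where psi' is [dpsi]. *)
Definition is_solution (R : realType) (l : R) (V : R -> R[i]) (k : R[i])
    (psi dpsi : R -> R[i]) : Prop :=
  [/\ ccontinuous_on `[0, l] psi,
      ccontinuous_on `[0, l] dpsi,
      forall x, 0 < x < l -> cderiv psi x (dpsi x) &
      forall x, 0 < x < l ->
        exists2 d, cderiv dpsi x d & - d + V x * psi x = k ^+ 2 * psi x].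

Definition val_der (R : realType) (psi dpsi : R -> R[i]) (x : R) : 'cV[R[i]]_2 :=
  \col_(i < 2) (if i == 0 then psi x else dpsi x).

Definition sigma (R : realType) : 'M[R[i]]_2 :=
  diag_mx (\row_(i < 2) (if i == 0 then 1 else -1)).

(* Each oriented edge e is parametrised by [0, len e] from [src e] to [tgt e],
   and derivatives are taken in the direction of e. *)
Record quantum_graph (R : realType) (n m : nat) := QuantumGraph {
  qgraph :> graph n m;
  len : 'I_(2 * m) -> R;
  len_gt0 : forall e, 0 < len e;
  len_rev : forall e, len (orev qgraph e) = len e;
  pot : 'I_(2 * m) -> R -> R[i];
  pot_rev : forall e x, 0 <= x <= len e ->
    pot (orev qgraph e) x = pot e (len e - x);
  transfer : 'I_(2 * m) -> R[i] -> 'M[R[i]]_2;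
  transfer_solution : forall e k psi dpsi,
    is_solution (len e) (pot e) k psi dpsi ->
    val_der psi dpsi (len e) = transfer e k *m val_der psi dpsi 0;
  transfer_entire : forall e i j, entire (fun k => transfer e k i j);
  transfer_unit : forall e k, transfer e k \in unitmx;
  transfer_rev : forall e k,
    transfer (orev qgraph e) k = sigma R *m invmx (transfer e k) *m sigma R }.

Section Matrices.
Variables (R : realType) (n m : nat).

Definition hat p q (M : 'M[R[i]]_(p, q)) : 'M[R[i]]_(p * 2, q * 2) :=
  tensmx M (1%:M : 'M[R[i]]_2).

Definition block p q (M : 'M[R[i]]_(p * 2, q * 2)) (i : 'I_p) (j : 'I_q) :
    'M[R[i]]_2 :=
  \matrix_(a, b) M (mxtens_index (i, a)) (mxtens_index (j, b)).

Definition blockdiag p (F : 'I_p -> 'M[R[i]]_2) : 'M[R[i]]_(p * 2) :=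
  \sum_(e < p) tensmx (delta_mx e e) (F e).

Variable G : graph n m.

Definition delta_t_star : 'M[R[i]]_(n, 2 * m) :=
  \matrix_(v, e) (v == tgt G e)%:R.

Definition delta_t : 'M[R[i]]_(2 * m, n) := delta_t_star ^t*.

Definition tau : 'M[R[i]]_(2 * m) :=
  perm_mx (perm (inv_inj (orev_involutive G))).

End Matrices.

Definition Phi (R : realType) (n m : nat) (Q : quantum_graph R n m) (k : R[i]) :
    'M[R[i]]_(2 * m * 2) :=
  blockdiag (fun e => transfer Q e k).

(* The middle factor is the Cayley transform (1 - X)(1 + X)^-1 of X = Phi tau.
   Its (e, -e) block is -2 (Phi_e^-1 - Phi_(-e))^-1 and its (e, e) block is
   (Phi_(-e)^-1 + Phi_e)(Phi_(-e)^-1 - Phi_e)^-1: the source prints the former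
   without the minus sign and the latter without the outer inverse. A loop at v
   contributes (e, -e) blocks to the diagonal block at v. *)
Definition frakA (R : realType) (n m : nat) (Q : quantum_graph R n m)
    (k : R[i]) : 'M[R[i]]_(n * 2) :=
  hat (delta_t_star R Q)
    *m (2 *: invmx (1%:M + Phi Q k *m hat (tau R Q)) - 1%:M)
    *m hat (delta_t R Q).

(* Main.v *)
(* Read in 2 x 2 blocks, X = Phi tau has the single nonzero block Phi_e in row
   e, at column -e, so X^2 is block diagonal with blocks Phi_e Phi_(-e). Hence
   (1 + X)^-1 = (1 - X^2)^-1 (1 - X), whose row e has only the blocks D_e at e
   and - D_e Phi_e at -e, where D_e = (1 - Phi_e Phi_(-e))^-1. Conjugating by
   delta_t sums these blocks over the edges ending at v (rows) and w (columns);
   the terms at (e, -e) are then reindexed by e -> -e. *)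

Require Import Defs.
From HB Require Import structures.
From mathcomp Require Import all_boot all_order all_algebra all_fingroup.
From mathcomp Require Import spectral.
From mathcomp Require Import all_classical all_reals all_analysis.
From mathcomp Require Import complex mxtens.

Set Implicit Arguments.
Unset Strict Implicit.
Unset Printing Implicit Defensive.

Import Order.TTheory GRing.Theory Num.Theory.
Import numFieldNormedType.Exports.
Local Open Scope ring_scope.

Section InverseTransfer.
Variables (C : comUnitRingType) (n : nat).
Implicit Types A B P S : 'M[C]_n.

Lemma invmx_eq A B : A *m B = 1%:M -> invmx A = B.
Proof.
by move=> AB; have [uA _] := mulmx1_unit AB; rewrite -(mulKmx uA B) AB mulmx1.
Qed.

(** Factor P^-1 - S = P^-1 (1 - P S). This turns a block D_e Phi_e of the resolvent into the inverse
    of a difference. *)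
Lemma invmx_subV P S : 1%:M - P *m S \in unitmx -> P \in unitmx ->
  invmx (invmx P - S) = invmx (1%:M - P *m S) *m P.
Proof.
move=> uPS uP; apply: invmx_eq; apply: mulmx1C.
by rewrite -mulmxA mulmxBr mulmxV // mulVmx.
Qed.

(** Since S^-1 - P = (1 - P S) S^-1, its inverse is S D with D = (1 - P S)^-1, so the left side is D
    + P S D. Subtracting this from 2 D leaves D - P S D = 1. *)
Lemma cayley_mx P S : 1%:M - P *m S \in unitmx -> S \in unitmx ->
  (invmx S + P) *m invmx (invmx S - P) = 2 *: invmx (1%:M - P *m S) - 1%:M.
Proof.
move=> uPS uS; set D := invmx (1%:M - _).
have -> : invmx (invmx S - P) = S *m D.
  by apply: invmx_eq; rewrite mulmxA mulmxBl mulVmx // /D mulmxV.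
have e : D - P *m S *m D = 1%:M by rewrite -{1}[D]mul1mx -mulmxBl /D mulmxV.
rewrite mulmxA mulmxDl mulVmx // mulmxDl mul1mx -e.
by rewrite scaler_nat mulr2n addrKA opprK.
Qed.

End InverseTransfer.

Section Blocks.
Variable R : realType.
Implicit Types p q r : nat.

Lemma block_ext p q (M N : 'M[R[i]]_(p * 2, q * 2)) :
  (forall i j, block M i j = block N i j) -> M = N.
Proof.
move=> eMN; apply/matrixP => x y.
case: (mxtens_indexP x) => i a; case: (mxtens_indexP y) => j b.
by have /matrixP/(_ a b) := eMN i j; rewrite !mxE.
Qed.

Lemma blockD p q (M N : 'M[R[i]]_(p * 2, q * 2)) i j :
  block (M + N) i j = block M i j + block N i j.
Proof. by apply/matrixP => a b; rewrite !mxE. Qed.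

Lemma blockN p q (M : 'M[R[i]]_(p * 2, q * 2)) i j :
  block (- M) i j = - block M i j.
Proof. by apply/matrixP => a b; rewrite !mxE. Qed.

Lemma blockZ p q c (M : 'M[R[i]]_(p * 2, q * 2)) i j :
  block (c *: M) i j = c *: block M i j.
Proof. by apply/matrixP => a b; rewrite !mxE. Qed.

Lemma blockM p q r (M : 'M[R[i]]_(p * 2, q * 2)) (N : 'M[R[i]]_(q * 2, r * 2))
    i j :
  block (M *m N) i j = \sum_l block M i l *m block N l j.
Proof.
apply/matrixP => a b; rewrite mxE [LHS]mxE summxE.
rewrite (reindex (@mxtens_index q 2)) /=; last first.
  exists (@mxtens_unindex q 2) => x _; first exact: mxtens_indexK.
  exact: mxtens_unindexK.
rewrite (eq_bigr (fun x => block M i x.1 a x.2 * block N x.1 j x.2 b));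
  last first.
  by case=> l c _; rewrite !mxE.
rewrite -(pair_bigA _ (fun l c => block M i l a c * block N l j c b)) /=.
by apply: eq_bigr => l _; rewrite !mxE.
Qed.

Lemma block_hat p q (M : 'M[R[i]]_(p, q)) i j : block (hat M) i j = (M i j)%:M.
Proof. by apply/matrixP => a b; rewrite mxE tensmxE !mxE mulr_natr. Qed.

Lemma block1 p i j : block (1%:M : 'M[R[i]]_(p * 2)) i j = (i == j)%:R%:M.
Proof.
apply/matrixP => a b; rewrite !mxE (inj_eq (can_inj (@mxtens_indexK p 2))).
by rewrite xpair_eqE; do 2!case: eqP.
Qed.

Lemma block_blockdiag p (F : 'I_p -> 'M[R[i]]_2) i j :
  block (blockdiag F) i j = if i == j then F i else 0.
Proof.
apply/matrixP => a b; rewrite mxE summxE (bigD1 i) //= tensmxE mxE eqxx /=.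
rewrite big1 => [|l li]; last first.
  by rewrite tensmxE mxE eq_sym (negbTE li) mul0r.
by rewrite addr0 eq_sym; case: eqP => _; rewrite ?mul1r // mul0r mxE.
Qed.

Lemma block_blockdiagM p q (F : 'I_p -> 'M[R[i]]_2) (M : 'M[R[i]]_(p * 2, q * 2))
    i j :
  block (blockdiag F *m M) i j = F i *m block M i j.
Proof.
rewrite blockM (bigD1 i) //= big1 => [|l li]; last first.
  by rewrite block_blockdiag eq_sym (negbTE li) mul0mx.
by rewrite block_blockdiag eqxx addr0.
Qed.

(** The blocks of a hatted matrix are scalar matrices, hence commute with the blocks of [M] and
    leave only numerical weights. *)
Lemma block_hat_mul p q (A : 'M[R[i]]_(p, q)) (M : 'M[R[i]]_(q * 2))
    (B : 'M[R[i]]_(q, p)) v w :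
  block (hat A *m M *m hat B) v w =
    \sum_e \sum_f (A v e * B f w) *: block M e f.
Proof.
rewrite blockM exchange_big; apply: eq_bigr => f _.
rewrite blockM mulmx_suml; apply: eq_bigr => e _.
by rewrite !block_hat mul_scalar_mx mul_mx_scalar scalerA mulrC.
Qed.

End Blocks.

Section Vertices.
Variables (R : realType) (n m : nat) (Q : quantum_graph R n m) (k : R[i]).
Hypothesis hk : forall e : 'I_(2 * m),
  1%:M - transfer Q e k *m transfer Q (orev Q e) k \in unitmx.

Local Notation P e := (transfer Q e k).
Local Notation D e := (invmx (1%:M - P e *m P (orev Q e))).

Lemma block_Phi_tau e f :
  block (Phi Q k *m hat (tau R Q)) e f = if orev Q e == f then P e else 0.
Proof.
rewrite block_blockdiagM block_hat !mxE permE.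
by case: eqP => _; rewrite ?mulmx1 // (_ : 0%:M = 0) ?mulmx0 // raddf0.
Qed.

(** The explicit candidate (1 - X^2)^-1 (1 - X) for (1 + X)^-1, where X = Phi tau and 1 - X^2 is
    inverted block by block. *)
Definition Phi_tau_resolvent : 'M[R[i]]_(2 * m * 2) :=
  blockdiag (fun e => D e) *m (1%:M - Phi Q k *m hat (tau R Q)).

Lemma block_resolvent e f :
  block Phi_tau_resolvent e f =
    (e == f)%:R *: D e - (orev Q e == f)%:R *: (D e *m P e).
Proof.
rewrite block_blockdiagM blockD blockN block1 block_Phi_tau mulmxBr.
rewrite mul_mx_scalar; congr (_ - _).
by case: eqP => _; rewrite ?scale1r // scale0r mulmx0.
Qed.

(** For square matrices a left inverse is enough: it gives both the invertibility of 1 + X and the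
    value of its inverse. *)
Lemma Phi_tau_resolventK :
  Phi_tau_resolvent *m (1%:M + Phi Q k *m hat (tau R Q)) = 1%:M.
Proof.
set X := _ *m hat _; rewrite /Phi_tau_resolvent -/X -mulmxA.
have -> : (1%:M - X) *m (1%:M + X) =
    blockdiag (fun e => 1%:M - P e *m P (orev Q e)).
  rewrite mulmxBl mul1mx mulmxDr mulmx1 opprD addrA addrK.
  apply: block_ext => e f; rewrite blockD blockN block1 block_blockdiag blockM.
  (* Row e of X meets only column -e, and row -e only column e, so X^2 lives on the diagonal. *)
  rewrite (bigD1 (orev Q e)) //= big1 => [|l le]; last first.
    by rewrite block_Phi_tau eq_sym (negbTE le) mul0mx.
  rewrite !block_Phi_tau eqxx orev_involutive addr0.
  by case: eqP => _ //; rewrite mulmx0 subr0 raddf0.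
apply: block_ext => e f; rewrite block1 block_blockdiagM block_blockdiag.
by case: eqP => _; rewrite ?mulVmx // mulmx0 raddf0.
Qed.

(** Only columns f = e and f = -e survive in row e. The first gives the sum over common terminal
    vertices, the second the sum involving sources, because t(-e) = s(e). *)
Lemma block_frakA v w :
  block (frakA Q k) v w =
    \sum_(e | (tgt Q e == v) && (tgt Q e == w)) (2 *: D e - 1%:M)
    - 2 *: \sum_(e | (tgt Q e == v) && (src Q e == w)) (D e *m P e).
Proof.
rewrite /frakA (invmx_eq (mulmx1C Phi_tau_resolventK)) block_hat_mul.
rewrite scaler_sumr !(big_mkcond (fun e => _ && _)) /= -sumrB.
apply: eq_bigr => e _.
(* The weight from the two incidence matrices; its factors are 0 or 1, so the conjugation in the
   adjoint has no effect on them. *)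
pose c f : R[i] := ((v == tgt Q e) && (w == tgt Q f))%:R.
rewrite (eq_bigr (fun f => (f == e)%:R *: (c f *: (2 *: D e - 1%:M))
    - (f == orev Q e)%:R *: (c f *: (2 *: (D e *m P e))))); last first.
  move=> f _; rewrite !mxE conjC_nat -natrM mulnb -/(c f).
  rewrite blockD blockZ blockN block1 block_resolvent !(eq_sym f).
  rewrite !scalerA !(mulrC _%:R (c f)) -!scalerA -scalerBr; congr (_ *: _).
  case: (e == f); rewrite ?scale1r ?scale0r.
    by rewrite scalerBr addrAC !scalerA mulrC.
  by rewrite !sub0r raddf0 subr0 scalerN !scalerA mulrC.
have pick g (F : 'I_(2 * m) -> 'M[R[i]]_2) :
    \sum_f (f == g)%:R *: F f = F g.
  rewrite (bigD1 g) //= eqxx scale1r big1 ?addr0 // => f /negbTE ->.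
  by rewrite scale0r.
(* Here t(-e) becomes s(e), by [src_orev] taken at -e. *)
rewrite sumrB !pick /c -(src_orev Q (orev Q e)) orev_involutive.
rewrite !(eq_sym v) !(eq_sym w).
by congr (_ - _); case: (_ && _); rewrite ?scale1r ?scale0r.
Qed.

End Vertices.

Theorem corollary3p1 (R : realType) (n m : nat) (Q : quantum_graph R n m)
    (k : R[i])
    (hk : forall e : 'I_(2 * m),
       1%:M - transfer Q e k *m transfer Q (orev Q e) k \in unitmx) :
  1%:M + Phi Q k *m hat (tau R Q) \in unitmx /\
  forall v w : 'I_n,
    block (frakA Q k) v w =
    if v != w then
      - (2 *: \sum_(e | (src Q e == v) && (tgt Q e == w))
                invmx (invmx (transfer Q (orev Q e) k) - transfer Q e k))
    else
      \sum_(e | tgt Q e == v)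
         (invmx (transfer Q (orev Q e) k) + transfer Q e k) *m
         invmx (invmx (transfer Q (orev Q e) k) - transfer Q e k)
      - 2 *: \sum_(e | (src Q e == v) && (tgt Q e == v))
                invmx (invmx (transfer Q (orev Q e) k) - transfer Q e k).
Proof.
split; first by have [] := mulmx1_unit (Phi_tau_resolventK hk).
move=> v w; rewrite block_frakA //.
have -> : \sum_(e | (tgt Q e == v) && (src Q e == w))
    (invmx (1%:M - transfer Q e k *m transfer Q (orev Q e) k) *m transfer Q e k)
  = \sum_(e | (src Q e == v) && (tgt Q e == w))
      invmx (invmx (transfer Q (orev Q e) k) - transfer Q e k).
  (* Under e -> -e, edges from w to v become edges from v to w, and the summand becomes D_(-e)
     Phi_(-e), which [invmx_subV] rewrites with P = Phi_(-e) and S = Phi_e. *)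
  rewrite (reindex_inj (inv_inj (orev_involutive Q))) /=.
  apply: eq_big => [e|e _]; first by rewrite -src_orev orev_involutive src_orev.
  have := hk (orev Q e); rewrite orev_involutive => uPS.
  by rewrite invmx_subV ?transfer_unit.
(* For v = w the second sum remains and runs over the loops at v. *)
case: eqP => [<-|/eqP vw] /=.
  congr (_ - _); apply: eq_big => [e|e _]; first by rewrite andbb.
  by rewrite cayley_mx ?transfer_unit.
(* For distinct v and w the first sum is empty: an edge has one terminal vertex. *)
rewrite big1 ?sub0r // => e /andP[/eqP tv /eqP tw].
by rewrite -tv -tw eqxx in vw.
Qed.
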